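(* Let $(\mathcal{C},\mathbb{E},\mathfrak{s})$ be an extriangulated category. If $\xi$ is a proper class of $\mathbb{E}$-triangles, then the following conditions are equivalent. (1) $\xi$ is saturated. (2) $\xi$ satisfies the $3\times3$-lemma property: for any commutative diagram of $\mathbb{E}$-triangles with rows $$A\xrightarrow{a}B\xrightarrow{b}C\overset{\varepsilon_1}{\dashrightarrow},\qquad D\xrightarrow{d}E\xrightarrow{e}G\overset{\varepsilon_2}{\dashrightarrow},\qquad H\xrightarrow{g}I\xrightarrow{h}J\overset{\varepsilon_3}{\dashrightarrow}$$ (first, middle and third row, respectively) and columns $$A\xrightarrow{i}D\xrightarrow{k}H\overset{\eta_1}{\dashrightarrow},\qquad B\xrightarrow{j}E\xrightarrow{l}I\overset{\eta_2}{\dashrightarrow},\qquad C\xrightarrow{c}G\xrightarrow{f}J\overset{\eta_3}{\dashrightarrow}$$ (so that $ja=di$, $cb=ej$, $ld=gk$, $fe=hl$) such that $(i,j,c)$ (from the first row to the middle row) or $(k,l,f)$ (from the middle row to the third row) is a morphism of $\mathbb{E}$-triangles, if all columns and the first and third rows belong to $\xi$, then the middle row also belongs to $\xi$.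
   Context: **Extriangulated categories (Nakaoka--Palu).** $\mathcal{C}$ is an additive category and $\mathbb{E}:\mathcal{C}^{\mathrm{op}}\times\mathcal{C}\to\mathrm{Ab}$ is an additive bifunctor. An element $\delta\in\mathbb{E}(C,A)$ is called an $\mathbb{E}$-extension. For $a:A\to A'$ and $c:C'\to C$ write $a\cdot\delta:=\mathbb{E}(C,a)(\delta)\in\mathbb{E}(C,A')$ and $\delta\cdot c:=\mathbb{E}(c,A)(\delta)\in\mathbb{E}(C',A)$. For $\delta\in\mathbb{E}(C,A)$, $\delta'\in\mathbb{E}(C',A')$, a morphism of $\mathbb{E}$-extensions $(a,c):\delta\to\delta'$ is a pair $a:A\to A'$, $c:C\to C'$ with $a\cdot\delta=\delta'\cdot c$. Two sequences $A\xrightarrow{x}B\xrightarrow{y}C$ and $A\xrightarrow{x'}B'\xrightarrow{y'}C$ are equivalent if there is an isomorphism $b:B\to B'$ with $bx=x'$, $y'b=y$; $[A\xrightarrow{x}B\xrightarrow{y}C]$ denotes the equivalence class. The additive realization $\mathfrak{s}$ assigns to each $\delta\in\mathbb{E}(C,A)$ an equivalence class $\mathfrak{s}(\delta)=[A\xrightarrow{x}B\xrightarrow{y}C]$ (any representative is said to realize $\delta$) such that: for each morphism $(a,c):\delta\to\delta'$ with $\mathfrak{s}(\delta)=[A\xrightarrow{x}B\xrightarrow{y}C]$, $\mathfrak{s}(\delta')=[A'\xrightarrow{x'}B'\xrightarrow{y'}C']$ there is $b:B\to B'$ with $bx=x'a$, $cy=y'b$; $\mathfrak{s}(0)=[A\to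 A\oplus C\to C]$ (canonical inclusion and projection); and $\mathfrak{s}(\delta\oplus\delta')=\mathfrak{s}(\delta)\oplus\mathfrak{s}(\delta')$. If $A\xrightarrow{x}B\xrightarrow{y}C$ realizes $\delta$, the pair, written $A\xrightarrow{x}B\xrightarrow{y}C\overset{\delta}{\dashrightarrow}$, is called an $\mathbb{E}$-triangle; it is split if $\delta=0$. The triplet $(\mathcal{C},\mathbb{E},\mathfrak{s})$ is an extriangulated category if moreover: (ET3) for $\mathbb{E}$-triangles $A\xrightarrow{x}B\xrightarrow{y}C\overset{\delta}{\dashrightarrow}$ and $A'\xrightarrow{x'}B'\xrightarrow{y'}C'\overset{\delta'}{\dashrightarrow}$ and morphisms $a,b$ with $bx=x'a$, there is $c:C\to C'$ with $cy=y'b$ and $a\cdot\delta=\delta'\cdot c$; and (ET3)$^{\mathrm{op}}$, the dual. (ET4) for $\mathbb{E}$-triangles $A\xrightarrow{f}B\xrightarrow{f'}D\overset{\delta}{\dashrightarrow}$ and $B\xrightarrow{g}C\xrightarrow{g'}F\overset{\delta'}{\dashrightarrow}$ there are an $\mathbb{E}$-triangle $A\xrightarrow{gf}C\xrightarrow{h'}E\overset{\delta''}{\dashrightarrow}$ and an $\mathbb{E}$-triangle $D\xrightarrow{d}E\xrightarrow{e}F\overset{f'\cdot\delta'}{\dashrightarrow}$ with $df'=h'g$, $eh'=g'$, $\delta''\cdot d=\delta$, $f\cdot\delta''=\delta'\cdot e$; and (ET4)$^{\mathrm{op}}$, the dual. **Morphisms of $\mathbb{E}$-triangles.** A morphism of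 $\mathbb{E}$-triangles from $A\xrightarrow{x}B\xrightarrow{y}C\overset{\delta}{\dashrightarrow}$ to $A'\xrightarrow{x'}B'\xrightarrow{y'}C'\overset{\delta'}{\dashrightarrow}$ is a triplet $(a,b,c)$ of morphisms $a:A\to A'$, $b:B\to B'$, $c:C\to C'$ with $bx=x'a$, $cy=y'b$ and $a\cdot\delta=\delta'\cdot c$. It is an isomorphism if $a,b,c$ are isomorphisms. **Proper classes.** A class $\xi$ of $\mathbb{E}$-triangles closed under isomorphisms is a proper class if: (i) $\xi$ contains all split $\mathbb{E}$-triangles; (ii) $\xi$ is closed under finite coproducts; (iii) $\xi$ is closed under base change and co-base change, i.e. if an $\mathbb{E}$-triangle $A\to B\to C\overset{\delta}{\dashrightarrow}$ is in $\xi$, then for all $c:C'\to C$ and $a:A\to A'$ every $\mathbb{E}$-triangle $A\to B'\to C'\overset{\delta\cdot c}{\dashrightarrow}$ and every $\mathbb{E}$-triangle $A'\to B''\to C\overset{a\cdot\delta}{\dashrightarrow}$ is in $\xi$. A proper class is not required to be saturated. **Saturated.** $\xi$ is saturated if the following holds. Let $A_1\xrightarrow{x_1}B_1\xrightarrow{y_1}C\overset{\delta_1}{\dashrightarrow}$ and $A_2\xrightarrow{x_2}B_2\xrightarrow{y_2}C\overset{\delta_2}{\dashrightarrow}$ be $\mathbb{E}$-triangles, and let $A_1\xrightarrow{m_1}M\xrightarrow{e_1}B_2\overset{\delta_1\cdot y_2}{\dashrightarrow}$ and $A_2\xrightarrow{m_2}M\xrightarrow{e_2}B_1\overset{\delta_2\cdot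 y_1}{\dashrightarrow}$ be $\mathbb{E}$-triangles with $e_2m_1=x_1$, $e_1m_2=x_2$, $y_1e_2=y_2e_1$ and $m_1\cdot\delta_1+m_2\cdot\delta_2=0$ (such a diagram always exists). If $A_2\xrightarrow{x_2}B_2\xrightarrow{y_2}C\overset{\delta_2}{\dashrightarrow}$ and $A_1\xrightarrow{m_1}M\xrightarrow{e_1}B_2\overset{\delta_1\cdot y_2}{\dashrightarrow}$ belong to $\xi$, then $A_1\xrightarrow{x_1}B_1\xrightarrow{y_1}C\overset{\delta_1}{\dashrightarrow}$ belongs to $\xi$. *)

(* Defs.v *)
From mathcomp Require Import all_boot ssralg.

Set Implicit Arguments.
Unset Strict Implicit.
Unset Printing Implicit Defensive.

Import GRing.Theory.
Local Open Scope ring_scope.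

Declare Scope excat_scope.
Delimit Scope excat_scope with X.
Open Scope excat_scope.

Reserved Notation "g ∘ f" (at level 40, left associativity).
Reserved Notation "A ⊕ B" (at level 50, left associativity).
Reserved Notation "a ▷ d" (at level 45, right associativity).
Reserved Notation "d ◁ c" (at level 40, left associativity).

(** ** Additive categories *)

(* The zero object and the binary biproducts are chosen. *)
Record additive_category := AdditiveCategory {
  Ob :> Type;
  Hom : Ob -> Ob -> zmodType;
  idm : forall A, Hom A A;
  comp : forall A B C, Hom B C -> Hom A B -> Hom A C;
  compA : forall A B C D (h : Hom C D) (g : Hom B C) (f : Hom A B),
    comp h (comp g f) = comp (comp h g) f;
  comp1m : forall A B (f : Hom A B), comp (idm B) f = f;
  compm1 : forall A B (f : Hom A B), comp f (idm A) = f;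
  compDl : forall A B C (g g' : Hom B C) (f : Hom A B),
    comp (g + g') f = comp g f + comp g' f;
  compDr : forall A B C (g : Hom B C) (f f' : Hom A B),
    comp g (f + f') = comp g f + comp g f';
  zero_ob : Ob;
  zero_obP : idm zero_ob = 0;
  biprod : Ob -> Ob -> Ob;
  in1 : forall A B, Hom A (biprod A B);
  in2 : forall A B, Hom B (biprod A B);
  pr1 : forall A B, Hom (biprod A B) A;
  pr2 : forall A B, Hom (biprod A B) B;
  pr1_in1 : forall A B, comp (pr1 A B) (in1 A B) = idm A;
  pr2_in2 : forall A B, comp (pr2 A B) (in2 A B) = idm B;
  pr1_in2 : forall A B, comp (pr1 A B) (in2 A B) = 0;
  pr2_in1 : forall A B, comp (pr2 A B) (in1 A B) = 0;
  in_pr_sum : forall A B,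
    comp (in1 A B) (pr1 A B) + comp (in2 A B) (pr2 A B) = idm (biprod A B)
}.

Arguments idm {_} A.
Arguments comp {_ A B C} g f.
Arguments zero_ob {_}.
Arguments biprod {_} A B.
Arguments in1 {_} A B.
Arguments in2 {_} A B.
Arguments pr1 {_} A B.
Arguments pr2 {_} A B.

Notation "g ∘ f" := (comp g f) : excat_scope.
Notation "A ⊕ B" := (biprod A B) : excat_scope.

Definition is_iso (C : additive_category) (A B : C) (f : Hom A B) : Prop :=
  exists g : Hom B A, g ∘ f = idm A /\ f ∘ g = idm B.

Definition sum_mor (C : additive_category) (A A' B B' : C)
    (f : Hom A B) (f' : Hom A' B') : Hom (A ⊕ A') (B ⊕ B') :=
  (in1 B B' ∘ f) ∘ pr1 A A' + (in2 B B' ∘ f') ∘ pr2 A A'.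

(** ** Additive bifunctors C^op x C -> Ab *)

(* [push a] is E(C, a) and [pull c] is E(c, A). *)
Record additive_bifunctor (C : additive_category) := AdditiveBifunctor {
  Ext :> C -> C -> zmodType;
  push : forall (Z A A' : C), Hom A A' -> Ext Z A -> Ext Z A';
  pull : forall (Z Z' A : C), Hom Z' Z -> Ext Z A -> Ext Z' A;
  pushD : forall (Z A A' : C) (a : Hom A A'),
    {morph @push Z A A' a : d d' / d + d'};
  pullD : forall (Z Z' A : C) (c : Hom Z' Z),
    {morph @pull Z Z' A c : d d' / d + d'};
  push_id : forall (Z A : C) (d : Ext Z A), push (idm A) d = d;
  pull_id : forall (Z A : C) (d : Ext Z A), pull (idm Z) d = d;
  push_comp : forall (Z A A' A'' : C) (a' : Hom A' A'') (a : Hom A A')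
    (d : Ext Z A), push (a' ∘ a) d = push a' (push a d);
  pull_comp : forall (Z Z' Z'' A : C) (c : Hom Z' Z) (c' : Hom Z'' Z')
    (d : Ext Z A), pull (c ∘ c') d = pull c' (pull c d);
  push_pull : forall (Z Z' A A' : C) (a : Hom A A') (c : Hom Z' Z)
    (d : Ext Z A), push a (pull c d) = pull c (push a d);
  push_addm : forall (Z A A' : C) (a a' : Hom A A') (d : Ext Z A),
    push (a + a') d = push a d + push a' d;
  pull_addm : forall (Z Z' A : C) (c c' : Hom Z' Z) (d : Ext Z A),
    pull (c + c') d = pull c d + pull c' d
}.

Arguments push {C _ Z A A'} a d.
Arguments pull {C _ Z Z' A} c d.

Notation "a ▷ d" := (push a d) : excat_scope.
Notation "d ◁ c" := (pull c d) : excat_scope.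

(* The element of E(Z ⊕ Z', A ⊕ A') with components (d, 0, 0, d') under
   E(Z ⊕ Z', A ⊕ A') ≅ E(Z, A) ⊕ E(Z, A') ⊕ E(Z', A) ⊕ E(Z', A'). *)
Definition sum_ext (C : additive_category) (E : additive_bifunctor C)
    (Z Z' A A' : C) (d : E Z A) (d' : E Z' A') : E (Z ⊕ Z') (A ⊕ A') :=
  in1 A A' ▷ (d ◁ pr1 Z Z') + in2 A A' ▷ (d' ◁ pr2 Z Z').

(** ** Additive realizations *)

Definition seq_equiv (C : additive_category) (A B B' Z : C)
    (x : Hom A B) (y : Hom B Z) (x' : Hom A B') (y' : Hom B' Z) : Prop :=
  exists b : Hom B B', [/\ is_iso b, b ∘ x = x' & y' ∘ b = y].

(* The equivalence class s(d) is represented by its membership predicate: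
   [realizes x y d] means that the sequence (x, y) belongs to s(d). *)
Record additive_realization (C : additive_category)
    (E : additive_bifunctor C) := AdditiveRealization {
  realizes : forall A B Z : C, Hom A B -> Hom B Z -> E Z A -> Prop;
  realizes_class : forall (A Z : C) (d : E Z A),
    exists (B : C) (x : Hom A B) (y : Hom B Z),
      forall (B' : C) (x' : Hom A B') (y' : Hom B' Z),
        realizes x' y' d <-> seq_equiv x y x' y';
  realizes_mor : forall (A B Z A' B' Z' : C)
    (x : Hom A B) (y : Hom B Z) (d : E Z A)
    (x' : Hom A' B') (y' : Hom B' Z') (d' : E Z' A')
    (a : Hom A A') (c : Hom Z Z'),
    realizes x y d -> realizes x' y' d' -> a ▷ d = d' ◁ c ->
    exists b : Hom B B', b ∘ x = x' ∘ a /\ c ∘ y = y' ∘ b;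
  realizes_zero : forall A Z : C, realizes (in1 A Z) (pr2 A Z) (0 : E Z A);
  realizes_sum : forall (A B Z A' B' Z' : C)
    (x : Hom A B) (y : Hom B Z) (d : E Z A)
    (x' : Hom A' B') (y' : Hom B' Z') (d' : E Z' A'),
    realizes x y d -> realizes x' y' d' ->
    realizes (sum_mor x x') (sum_mor y y') (sum_ext d d')
}.

Arguments realizes {C E} s {A B Z} x y d : rename.

(** ** Extriangulated categories *)

Record extriangulated_category := ExtriangulatedCategory {
  base :> additive_category;
  EE : additive_bifunctor base;
  ss : additive_realization EE;
  ET3 : forall (A B Z A' B' Z' : base)
    (x : Hom A B) (y : Hom B Z) (d : EE Z A)
    (x' : Hom A' B') (y' : Hom B' Z') (d' : EE Z' A')
    (a : Hom A A') (b : Hom B B'),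
    realizes ss x y d -> realizes ss x' y' d' -> b ∘ x = x' ∘ a ->
    exists c : Hom Z Z', c ∘ y = y' ∘ b /\ a ▷ d = d' ◁ c;
  ET3op : forall (A B Z A' B' Z' : base)
    (x : Hom A B) (y : Hom B Z) (d : EE Z A)
    (x' : Hom A' B') (y' : Hom B' Z') (d' : EE Z' A')
    (b : Hom B B') (c : Hom Z Z'),
    realizes ss x y d -> realizes ss x' y' d' -> c ∘ y = y' ∘ b ->
    exists a : Hom A A', b ∘ x = x' ∘ a /\ a ▷ d = d' ◁ c;
  ET4 : forall (A B Z D F : base)
    (f : Hom A B) (f' : Hom B D) (d1 : EE D A)
    (g : Hom B Z) (g' : Hom Z F) (d2 : EE F B),
    realizes ss f f' d1 -> realizes ss g g' d2 ->
    exists (E : base) (h' : Hom Z E) (d3 : EE E A) (d : Hom D E) (e : Hom E F),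
      [/\ realizes ss (g ∘ f) h' d3, realizes ss d e (f' ▷ d2) &
      [/\ d ∘ f' = h' ∘ g, e ∘ h' = g', d3 ◁ d = d1 & f ▷ d3 = d2 ◁ e]];
  ET4op : forall (A B Z D F : base)
    (f' : Hom D B) (f : Hom B A) (d1 : EE A D)
    (g' : Hom F Z) (g : Hom Z B) (d2 : EE B F),
    realizes ss f' f d1 -> realizes ss g' g d2 ->
    exists (E : base) (h' : Hom E Z) (d3 : EE A E) (d : Hom E D) (e : Hom F E),
      [/\ realizes ss h' (f ∘ g) d3, realizes ss e d (d2 ◁ f') &
      [/\ f' ∘ d = g ∘ h', h' ∘ e = g', d ▷ d3 = d1 & d3 ◁ f = e ▷ d2]]
}.

(** ** E-triangles *)

Record etriangle (X : extriangulated_category) := ETriangle {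
  tA : X; tB : X; tC : X;
  tx : Hom tA tB;
  ty : Hom tB tC;
  tdelta : EE X tC tA;
  t_realizes : realizes (ss X) tx ty tdelta
}.

Definition split_etriangle (X : extriangulated_category) (T : etriangle X) :
  Prop := tdelta T = 0.

Definition etriangle_mor (X : extriangulated_category) (T T' : etriangle X)
    (a : Hom (tA T) (tA T')) (b : Hom (tB T) (tB T'))
    (c : Hom (tC T) (tC T')) : Prop :=
  [/\ b ∘ tx T = tx T' ∘ a, c ∘ ty T = ty T' ∘ b
    & a ▷ tdelta T = tdelta T' ◁ c].

Definition etriangle_iso (X : extriangulated_category) (T T' : etriangle X)
    (a : Hom (tA T) (tA T')) (b : Hom (tB T) (tB T'))
    (c : Hom (tC T) (tC T')) : Prop :=
  etriangle_mor a b c /\ [/\ is_iso a, is_iso b & is_iso c].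

Definition etriangle_sum (X : extriangulated_category) (T T' : etriangle X) :
    etriangle X :=
  ETriangle (realizes_sum (t_realizes T) (t_realizes T')).

(** ** Classes of E-triangles *)

(* The empty coproduct is split, so binary coproducts give all finite ones. *)
Record proper_class (X : extriangulated_category) (xi : etriangle X -> Prop) :
    Prop := ProperClass {
  proper_iso : forall (T T' : etriangle X) (a : Hom (tA T) (tA T'))
    (b : Hom (tB T) (tB T')) (c : Hom (tC T) (tC T')),
    etriangle_iso a b c -> xi T -> xi T';
  proper_split : forall T : etriangle X, split_etriangle T -> xi T;
  proper_sum : forall T T' : etriangle X,
    xi T -> xi T' -> xi (etriangle_sum T T');
  proper_base_change : forall T : etriangle X, xi T ->
    forall (Z' B' : X) (c : Hom Z' (tC T)) (x' : Hom (tA T) B')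
      (y' : Hom B' Z') (r : realizes (ss X) x' y' (tdelta T ◁ c)),
    xi (ETriangle r);
  proper_cobase_change : forall T : etriangle X, xi T ->
    forall (A' B' : X) (a : Hom (tA T) A') (x' : Hom A' B')
      (y' : Hom B' (tC T)) (r : realizes (ss X) x' y' (a ▷ tdelta T)),
    xi (ETriangle r)
}.

Definition saturated (X : extriangulated_category) (xi : etriangle X -> Prop) :
    Prop :=
  forall (A1 A2 B1 B2 Z M : X)
    (x1 : Hom A1 B1) (y1 : Hom B1 Z) (d1 : EE X Z A1)
    (x2 : Hom A2 B2) (y2 : Hom B2 Z) (d2 : EE X Z A2)
    (m1 : Hom A1 M) (e1 : Hom M B2) (m2 : Hom A2 M) (e2 : Hom M B1)
    (r1 : realizes (ss X) x1 y1 d1)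
    (r2 : realizes (ss X) x2 y2 d2)
    (q1 : realizes (ss X) m1 e1 (d1 ◁ y2))
    (q2 : realizes (ss X) m2 e2 (d2 ◁ y1)),
    e2 ∘ m1 = x1 -> e1 ∘ m2 = x2 -> y1 ∘ e2 = y2 ∘ e1 ->
    m1 ▷ d1 + m2 ▷ d2 = 0 ->
    xi (ETriangle r2) -> xi (ETriangle q1) -> xi (ETriangle r1).

(* The diagram, with the four squares commuting:
     A -a-> B -b-> C  eps1
     |i     |j     |c
     D -d-> E -e-> G  eps2
     |k     |l     |f
     H -g-> I -h-> J  eps3
    eta1   eta2   eta3                                                      *)
Definition three_by_three (X : extriangulated_category)
    (xi : etriangle X -> Prop) : Prop :=
  forall (A B C D E G H I J : X)
    (a : Hom A B) (b : Hom B C) (eps1 : EE X C A)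
    (d : Hom D E) (e : Hom E G) (eps2 : EE X G D)
    (g : Hom H I) (h : Hom I J) (eps3 : EE X J H)
    (i : Hom A D) (k : Hom D H) (eta1 : EE X H A)
    (j : Hom B E) (l : Hom E I) (eta2 : EE X I B)
    (c : Hom C G) (f : Hom G J) (eta3 : EE X J C)
    (row1 : realizes (ss X) a b eps1)
    (row2 : realizes (ss X) d e eps2)
    (row3 : realizes (ss X) g h eps3)
    (col1 : realizes (ss X) i k eta1)
    (col2 : realizes (ss X) j l eta2)
    (col3 : realizes (ss X) c f eta3),
    j ∘ a = d ∘ i -> c ∘ b = e ∘ j -> l ∘ d = g ∘ k -> f ∘ e = h ∘ l ->
    @etriangle_mor X (ETriangle row1) (ETriangle row2) i j c \/
    @etriangle_mor X (ETriangle row2) (ETriangle row3) k l f ->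
    xi (ETriangle col1) -> xi (ETriangle col2) -> xi (ETriangle col3) ->
    xi (ETriangle row1) -> xi (ETriangle row3) -> xi (ETriangle row2).

(* Main.v *)
From mathcomp Require Import all_boot ssralg.
Require Import Defs.

(** The $\xi$-triangles over a proper class form an additive subbifunctor
    $F\subseteq\mathbb{E}$: membership of an $\mathbb{E}$-triangle depends only
    on its extension, and $F$ is stable under push, pull and addition
    ([ext_in_of], [ext_in_push], [ext_in_pull], [ext_in_add]).  Both conditions
    of the theorem are then statements about $F$, to be compared by means of the
    long exact sequences of an $\mathbb{E}$-triangle ([pull_exact_right],
    [push_exact_right], [push_exact_mid], [pull_exact_mid]).

    Saturation says that $F$ is detected by $\xi$-deflations: if $y$ is the
    deflation of a member of $F$ and $\delta\cdot y\in F$, then $\delta\in F$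
    ([saturated_deflation]); the completing diagram required by the definition
    comes from a realization of the extension with components
    $(\delta_1,\delta_2)$.  Detection by $\xi$-deflations implies detection by
    $\xi$-inflations ([inflation_detection]).

    Saturation gives the $3\times3$ property as follows, in the case where
    $k\cdot\varepsilon_2=\varepsilon_3\cdot f$.  Let $p$ be the deflation of
    this element of $F$.  Then $\varepsilon_2\cdot p$ is killed by $k$, so it is
    $i\cdot\theta$ for some $\theta$.  Since $ja=di$ and $d\cdot\varepsilon_2=0$,
    $a\cdot\theta$ is killed by $j$, so it is a pullback of $\eta_2$ and lies in
    $F$.  Detection along the inflation $a$, then along the deflation $p$, gives
    $\theta\in F$ and $\varepsilon_2\in F$.  The other case is dual.

    Conversely, given $\delta_2\in F$ and $\delta_1\cdot y_2\in F$, compose the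
    two deflations $M\to B_2\to C$ by (ET4)$^{\mathrm{op}}$.  The extension
    $\delta_3$ of the composite is the middle row of a $3\times3$ diagram whose
    first row and last column are trivial, so $\delta_3\in F$; and $\delta_1$ is
    a pushout of $\delta_3$ plus a pushout of $\delta_2$. *)

Set Implicit Arguments.
Unset Strict Implicit.
Unset Printing Implicit Defensive.

Import GRing.Theory.
Local Open Scope ring_scope.

(** * Additive categories and bifunctors *)

Section Additivity.
Variables (C : additive_category) (E : additive_bifunctor C).

Lemma comp0m (A B D : C) (f : Hom A B) : (0 : Hom B D) ∘ f = 0.
Proof. by apply: (addrI (0 ∘ f)); rewrite -compDl !addr0. Qed.

Lemma compm0 (A B D : C) (g : Hom B D) : g ∘ (0 : Hom A B) = 0.
Proof. by apply: (addrI (g ∘ 0)); rewrite -compDr !addr0. Qed.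

Lemma to_zero (A : C) (f : Hom A zero_ob) : f = 0.
Proof. by rewrite -[f]comp1m zero_obP comp0m. Qed.

Lemma from_zero (A : C) (f : Hom zero_ob A) : f = 0.
Proof. by rewrite -[f]compm1 zero_obP compm0. Qed.

Lemma push0 (Z A A' : C) (a : Hom A A') : a ▷ (0 : E Z A) = 0.
Proof. by apply: (addrI (a ▷ (0 : E Z A))); rewrite -pushD !addr0. Qed.

Lemma pull0 (Z Z' A : C) (c : Hom Z' Z) : (0 : E Z A) ◁ c = 0.
Proof. by apply: (addrI ((0 : E Z A) ◁ c)); rewrite -pullD !addr0. Qed.

Lemma push0m (Z A A' : C) (d : E Z A) : (0 : Hom A A') ▷ d = 0.
Proof. by apply: (addrI ((0 : Hom A A') ▷ d)); rewrite -push_addm !addr0. Qed.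

Lemma pull0m (Z Z' A : C) (d : E Z A) : d ◁ (0 : Hom Z' Z) = 0.
Proof. by apply: (addrI (d ◁ (0 : Hom Z' Z))); rewrite -pull_addm !addr0. Qed.

Lemma pullB (Z Z' A : C) (c : Hom Z' Z) (d d' : E Z A) :
  (d - d') ◁ c = d ◁ c - d' ◁ c.
Proof. by apply: (addIr (d' ◁ c)); rewrite -pullD !subrK. Qed.

Lemma is_iso_id (A : C) : is_iso (idm A).
Proof. by exists (idm A); rewrite comp1m. Qed.

Lemma is_iso_comp (A B D : C) (g : Hom B D) (f : Hom A B) :
  is_iso g -> is_iso f -> is_iso (g ∘ f).
Proof.
move=> [g' [g'g gg']] [f' [f'f ff']]; exists (f' ∘ g'); split.
- by rewrite compA -(compA f') g'g compm1.
- by rewrite compA -(compA g) ff' compm1.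
Qed.

Lemma seq_equiv_refl (A B Z : C) (x : Hom A B) (y : Hom B Z) :
  seq_equiv x y x y.
Proof. by exists (idm B); split; [exact: is_iso_id | exact: comp1m | exact: compm1]. Qed.

Lemma seq_equiv_sym (A B B' Z : C) (x : Hom A B) (y : Hom B Z)
    (x' : Hom A B') (y' : Hom B' Z) :
  seq_equiv x y x' y' -> seq_equiv x' y' x y.
Proof.
move=> [b [[b' [b'b bb']] <- <-]]; exists b'; split; first by exists b.
- by rewrite compA b'b comp1m.
- by rewrite -compA bb' compm1.
Qed.

Lemma seq_equiv_trans (A B B' B'' Z : C) (x : Hom A B) (y : Hom B Z)
    (x' : Hom A B') (y' : Hom B' Z) (x'' : Hom A B'') (y'' : Hom B'' Z) :
  seq_equiv x y x' y' -> seq_equiv x' y' x'' y'' -> seq_equiv x y x'' y''.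
Proof.
move=> [b [isob <- <-]] [b' [isob' <- <-]]; exists (b' ∘ b).
by split; [exact: is_iso_comp | rewrite compA | rewrite compA].
Qed.

End Additivity.

(** * Realizations *)

Section Realizations.
Variables (C : additive_category) (E : additive_bifunctor C).
Variable s : additive_realization E.

Lemma realizes_exists (Z A : C) (d : E Z A) :
  exists (B : C) (x : Hom A B) (y : Hom B Z), realizes s x y d.
Proof.
have [B [x [y xyP]]] := realizes_class s d.
by exists B, x, y; apply/xyP; exact: seq_equiv_refl.
Qed.

Lemma realizes_uniq (A B B' Z : C) (x : Hom A B) (y : Hom B Z)
    (x' : Hom A B') (y' : Hom B' Z) (d : E Z A) :
  realizes s x y d -> realizes s x' y' d -> seq_equiv x y x' y'.
Proof.
have [B0 [x0 [y0 xyP]]] := realizes_class s d.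
by move=> /xyP /seq_equiv_sym r /xyP; exact: seq_equiv_trans.
Qed.

Lemma realizes_equiv (A B B' Z : C) (x : Hom A B) (y : Hom B Z)
    (x' : Hom A B') (y' : Hom B' Z) (d : E Z A) :
  seq_equiv x y x' y' -> realizes s x y d -> realizes s x' y' d.
Proof.
have [B0 [x0 [y0 xyP]]] := realizes_class s d.
by move=> eq_xy /xyP r; apply/xyP; exact: seq_equiv_trans eq_xy.
Qed.

Lemma realizes_zero_swap (A Z : C) :
  realizes s (in2 Z A) (pr1 Z A) (0 : E Z A).
Proof.
apply: realizes_equiv (realizes_zero s A Z).
exists (in2 Z A ∘ pr1 A Z + in1 Z A ∘ pr2 A Z); split.
- exists (in2 A Z ∘ pr1 Z A + in1 A Z ∘ pr2 Z A); split.
  + rewrite compDl !compDr -!compA !(compA (pr1 Z A)) !(compA (pr2 Z A)).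
    rewrite pr1_in1 pr2_in2 pr1_in2 pr2_in1 !comp0m !compm0 !comp1m.
    by rewrite addr0 add0r addrC in_pr_sum.
  + rewrite compDl !compDr -!compA !(compA (pr1 A Z)) !(compA (pr2 A Z)).
    rewrite pr1_in1 pr2_in2 pr1_in2 pr2_in1 !comp0m !compm0 !comp1m.
    by rewrite addr0 add0r addrC in_pr_sum.
- by rewrite compDl -!compA pr1_in1 pr2_in1 compm0 compm1 addr0.
- by rewrite compDr !compA pr1_in1 pr1_in2 comp0m comp1m add0r.
Qed.

Lemma realizes_id_left (A : C) :
  realizes s (idm A) (0 : Hom A zero_ob) (0 : E zero_ob A).
Proof.
apply: realizes_equiv (realizes_zero s A zero_ob).
exists (pr1 A zero_ob); split.
- exists (in1 A zero_ob); rewrite pr1_in1; split=> //.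
  by rewrite -in_pr_sum [pr2 _ _]to_zero compm0 addr0.
- exact: pr1_in1.
- by rewrite comp0m [RHS]to_zero.
Qed.

Lemma realizes_id_right (Z : C) :
  realizes s (0 : Hom zero_ob Z) (idm Z) (0 : E Z zero_ob).
Proof.
apply: realizes_equiv (realizes_zero s zero_ob Z).
exists (pr2 zero_ob Z); split.
- exists (in2 zero_ob Z); rewrite pr2_in2; split=> //.
  by rewrite -in_pr_sum [pr1 _ _]to_zero compm0 add0r.
- by rewrite pr2_in1.
- exact: comp1m.
Qed.

Lemma split_retraction (A B Z : C) (x : Hom A B) (y : Hom B Z) :
  realizes s x y (0 : E Z A) -> exists r : Hom B A, r ∘ x = idm A.
Proof.
move=> /(realizes_uniq (realizes_zero s A Z)) [b [[b' [b'b _]] <- _]].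
by exists (pr1 A Z ∘ b'); rewrite compA -(compA _ b') b'b compm1 pr1_in1.
Qed.

Lemma split_section (A B Z : C) (x : Hom A B) (y : Hom B Z) :
  realizes s x y (0 : E Z A) -> exists t : Hom Z B, y ∘ t = idm Z.
Proof.
move=> /(realizes_uniq (realizes_zero s A Z)) [b [_ _ yb]].
by exists (b ∘ in2 A Z); rewrite compA yb pr2_in2.
Qed.

End Realizations.

(** * Exactness of the sequences of an extriangulated category *)

Section Exactness.
Variable X : extriangulated_category.

(** The pair $(x,1_B)$ extends to a morphism into the trivial triangle
    $B=B\to0$, whose extension is zero. *)
Lemma push_inflation (A B Z : X) (x : Hom A B) (y : Hom B Z) (d : EE X Z A) :
  realizes (ss X) x y d -> x ▷ d = 0.
Proof.
move=> r; have [|c [_ ->]] := ET3 (a := x) (b := idm B) r (realizes_id_left _ B).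
  by rewrite comp1m.
exact: pull0.
Qed.

Lemma pull_deflation (A B Z : X) (x : Hom A B) (y : Hom B Z) (d : EE X Z A) :
  realizes (ss X) x y d -> d ◁ y = 0.
Proof.
move=> r; have [|a [_ <-]] := ET3op (b := idm B) (c := y) (realizes_id_right _ B) r.
  by [].
exact: push0.
Qed.

Lemma deflation_inflation (A B Z : X) (x : Hom A B) (y : Hom B Z)
    (d : EE X Z A) :
  realizes (ss X) x y d -> y ∘ x = 0.
Proof.
move=> r; have [|c [<- _]] := ET3 (a := idm A) (b := x) (realizes_id_left _ A) r.
  by [].
exact: compm0.
Qed.

(** If $\zeta\cdot y=0$, then $y$ lifts through the deflation of $\zeta$; the
    lift extends to a morphism of triangles over the identity of $Z$, whose
    first component is the required map. *)
Lemma pull_exact_right (A B Z W : X) (x : Hom A B) (y : Hom B Z)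
    (d : EE X Z A) (z : EE X Z W) :
  realizes (ss X) x y d -> z ◁ y = 0 -> exists t : Hom A W, z = t ▷ d.
Proof.
move=> r zy0; have [V [u [v rz]]] := realizes_exists (ss X) z.
have [|b [_ yb]] := @realizes_mor _ _ (ss X) _ _ _ _ _ _ _ _ _ _ _ _
  (idm W) y (realizes_zero _ W B) rz; first by rewrite push_id zy0.
have [|t [_ tP]] := ET3op (b := b ∘ in2 W B) (c := idm Z) r rz.
  by rewrite comp1m compA -yb -compA pr2_in2 compm1.
by exists t; rewrite tP pull_id.
Qed.

Lemma push_exact_right (A B Z W : X) (x : Hom A B) (y : Hom B Z)
    (d : EE X Z A) (z : EE X W A) :
  realizes (ss X) x y d -> x ▷ z = 0 -> exists t : Hom W Z, z = d ◁ t.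
Proof.
move=> r xz0; have [V [u [v rz]]] := realizes_exists (ss X) z.
have [|b [bx _]] := @realizes_mor _ _ (ss X) _ _ _ _ _ _ _ _ _ _ _ _
  x (idm W) rz (realizes_zero _ B W); first by rewrite pull_id xz0.
have [|t [_ tP]] := ET3 (a := idm A) (b := pr1 B W ∘ b) rz r.
  by rewrite compm1 -compA bx compA pr1_in1 comp1m.
by exists t; rewrite -tP push_id.
Qed.

(** Composing the inflations of $d$ and $z$ by (ET4) produces a triangle with
    extension $y\cdot z=0$; a section of it carries the composite extension to
    the required preimage. *)
Lemma push_exact_mid (A B Z W : X) (x : Hom A B) (y : Hom B Z)
    (d : EE X Z A) (z : EE X W B) :
  realizes (ss X) x y d -> y ▷ z = 0 -> exists t : EE X W A, z = x ▷ t.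
Proof.
move=> r yz0; have [V [u [v rz]]] := realizes_exists (ss X) z.
have [E [h' [d3 [m [e [_ rme [_ _ _ xd3]]]]]]] := ET4 r rz.
rewrite yz0 in rme; have [t et] := split_section rme.
by exists (d3 ◁ t); rewrite push_pull xd3 -pull_comp et pull_id.
Qed.

Lemma pull_exact_mid (A B Z W : X) (x : Hom A B) (y : Hom B Z)
    (d : EE X Z A) (z : EE X B W) :
  realizes (ss X) x y d -> z ◁ x = 0 -> exists t : EE X Z W, z = t ◁ y.
Proof.
move=> r zx0; have [V [u [v rz]]] := realizes_exists (ss X) z.
have [E [h' [d3 [m [e [_ rem [_ _ _ d3y]]]]]]] := ET4op r rz.
rewrite zx0 in rem; have [t te] := split_retraction rem.
by exists (t ▷ d3); rewrite -push_pull d3y -push_comp te push_id.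
Qed.

(** Dividing the kernel $P$ of $y$ by a summand $A$ turns $y$ into the deflation
    of the other component of $\varepsilon$; the quotient map has the pullback
    of the first component as its extension. *)
Lemma quotient_by_summand (A P A' M Z : X) (i : Hom A P) (p : Hom P A')
    (q : Hom P A) (m : Hom P M) (y : Hom M Z) (eps : EE X Z P) :
  realizes (ss X) i p 0 -> q ∘ i = idm A -> realizes (ss X) m y eps ->
  exists (B : X) (x' : Hom A' B) (y' : Hom B Z) (e : Hom M B),
    [/\ realizes (ss X) x' y' (p ▷ eps),
        realizes (ss X) (m ∘ i) e ((q ▷ eps) ◁ y'),
        e ∘ m = x' ∘ p & y' ∘ e = y].
Proof.
move=> rip qi r; have [B [e [d3 [x' [y' [r3 r' [xp ye _ id3]]]]]]] := ET4 rip r.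
exists B, x', y', e; split=> //.
by rewrite -push_pull -id3 -push_comp qi push_id.
Qed.

End Exactness.

(** * The subbifunctor of a proper class *)

Section ProperClass.
Variables (X : extriangulated_category) (xi : etriangle X -> Prop).

Definition ext_in (Z A : X) (d : EE X Z A) : Prop :=
  forall (B : X) (x : Hom A B) (y : Hom B Z) (r : realizes (ss X) x y d),
    xi (ETriangle r).

Hypothesis hxi : proper_class xi.

Lemma ext_in_of (T : etriangle X) : xi T -> ext_in (tdelta T).
Proof.
move=> xiT B x y r.
have [b [isob bx yb]] := realizes_uniq (t_realizes T) r.
apply: (@proper_iso _ _ hxi T (ETriangle r) (idm _) b (idm _)) xiT.
split; last by split=> //; exact: is_iso_id.
by split=> /=; rewrite ?bx ?yb ?compm1 ?comp1m ?push_id ?pull_id.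
Qed.

Lemma ext_in_realized (Z A : X) (d : EE X Z A) (B : X) (x : Hom A B)
  (y : Hom B Z) (r : realizes (ss X) x y d) : xi (ETriangle r) -> ext_in d.
Proof. exact: (@ext_in_of (ETriangle r)). Qed.

Lemma ext_in_zero (Z A : X) : ext_in (0 : EE X Z A).
Proof. by move=> B x y r; exact: proper_split. Qed.

Lemma ext_in_push (Z A A' : X) (a : Hom A A') (d : EE X Z A) :
  ext_in d -> ext_in (a ▷ d).
Proof.
move=> Fd B' x' y' r'; have [B [x [y r]]] := realizes_exists (ss X) d.
exact: (@proper_cobase_change _ _ hxi (ETriangle r)).
Qed.

Lemma ext_in_pull (Z Z' A : X) (c : Hom Z' Z) (d : EE X Z A) :
  ext_in d -> ext_in (d ◁ c).
Proof.
move=> Fd B' x' y' r'; have [B [x [y r]]] := realizes_exists (ss X) d.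
exact: (@proper_base_change _ _ hxi (ETriangle r)).
Qed.

(** The Baer sum: $d+d'$ is the direct sum pulled back along the diagonal and
    pushed out along the codiagonal. *)
Lemma ext_in_add (Z A : X) (d d' : EE X Z A) :
  ext_in d -> ext_in d' -> ext_in (d + d').
Proof.
move=> Fd Fd'.
have [B [x [y r]]] := realizes_exists (ss X) d.
have [B' [x' [y' r']]] := realizes_exists (ss X) d'.
have /ext_in_of /= Fs := proper_sum hxi (Fd _ _ _ r) (Fd' _ _ _ r').
suff -> : d + d' =
    (pr1 A A + pr2 A A) ▷ (sum_ext d d' ◁ (in1 Z Z + in2 Z Z)).
  exact/ext_in_push/ext_in_pull.
rewrite /sum_ext pullD pushD -!push_pull -!push_comp !compDl -!pull_comp !compDr.
rewrite pr1_in1 pr2_in1 pr1_in2 pr2_in2 pr1_in1 pr1_in2 pr2_in1 pr2_in2.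
by rewrite !addr0 !add0r !push_id !pull_id.
Qed.

(** Saturation freed from its diagram, as a condition on extensions alone. *)
Definition deflation_detects : Prop :=
  forall (A1 A2 B Z : X) (x : Hom A2 B) (y : Hom B Z)
    (d1 : EE X Z A1) (d2 : EE X Z A2),
  realizes (ss X) x y d2 -> ext_in d2 -> ext_in (d1 ◁ y) -> ext_in d1.

(** The extension $\varepsilon$ with components $(\delta_1,\delta_2)$ in
    $\mathbb{E}(Z,A_1\oplus A_2)$ has a middle term $M$, and dividing $M$ by
    $A_1$ and by $A_2$ gives the two rows and columns of the completing
    diagram. *)
Lemma saturated_deflation : saturated xi -> deflation_detects.
Proof.
move=> sat A1 A2 B Z x y d1 d2 r Fd2 Fd1y.
pose eps := in1 A1 A2 ▷ d1 + in2 A1 A2 ▷ d2.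
have p1 : pr1 A1 A2 ▷ eps = d1.
  by rewrite pushD -!push_comp pr1_in1 pr1_in2 push_id push0m addr0.
have p2 : pr2 A1 A2 ▷ eps = d2.
  by rewrite pushD -!push_comp pr2_in1 pr2_in2 push_id push0m add0r.
have [M [m [z rM]]] := realizes_exists (ss X) eps.
have [B2 [x2 [y2 [e1 [r2 q1 e1m y2e1]]]]] :=
  quotient_by_summand (realizes_zero _ A1 A2) (pr1_in1 A1 A2) rM.
have [B1 [x1 [y1 [e2 [r1 q2 e2m y1e2]]]]] :=
  quotient_by_summand (realizes_zero_swap _ A2 A1) (pr2_in2 A1 A2) rM.
rewrite p2 in r2 q2; rewrite p1 in r1 q1.
(* The middle term of d2 obtained from M is only isomorphic to B. *)
have [b [_ _ yb]] := realizes_uniq r2 r.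
have Fq1 : ext_in (d1 ◁ y2) by rewrite -yb pull_comp; exact: ext_in_pull.
apply: (@ext_in_realized _ _ _ _ _ _ r1).
apply: (sat _ _ _ _ _ _ _ _ _ _ _ _ _ _ _ _ r1 r2 q1 q2); last 2 first.
- exact: Fd2.
- exact: Fq1.
- by rewrite compA e2m -compA pr1_in1 compm1.
- by rewrite compA e1m -compA pr2_in2 compm1.
- by rewrite y1e2.
- by rewrite !push_comp -pushD; exact: push_inflation rM.
Qed.

(** Let $m$ be the deflation of $x\cdot\delta_1$.  Then $\delta_1\cdot m$ is
    killed by $x$, so it is a pullback of $\delta_2$. *)
Lemma inflation_detection (A B Z1 Z2 : X) (x : Hom A B) (y : Hom B Z2)
    (d1 : EE X Z1 A) (d2 : EE X Z2 A) :
  deflation_detects ->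
  realizes (ss X) x y d2 -> ext_in d2 -> ext_in (x ▷ d1) -> ext_in d1.
Proof.
move=> det r Fd2 Fxd1; have [M [n [m rM]]] := realizes_exists (ss X) (x ▷ d1).
apply: (det _ _ _ _ _ _ _ _ rM Fxd1).
have [|t ->] := push_exact_right (z := d1 ◁ m) r; last exact: ext_in_pull.
by rewrite push_pull; exact: pull_deflation rM.
Qed.

(** * Comparison of the two conditions *)

Lemma saturated_three_by_three : saturated xi -> three_by_three xi.
Proof.
move=> /saturated_deflation det A B C D E G H I J a b eps1 d e eps2 g h eps3.
move=> i k eta1 j l eta2 c f eta3 row1 row2 row3 col1 col2 col3.
move=> ja cb ld fe morph _ /ext_in_of Feta2 _ xi1 xi3.
have Feps1 := ext_in_of xi1; have Feps3 := ext_in_of xi3.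
rewrite /= in Feta2 Feps1 Feps3.
suff : ext_in eps2 by apply.
case: morph => -[/= _ _].
- move=> ieps1.
  have Fieps1 : ext_in (i ▷ eps1) by exact: ext_in_push.
  have [Q [q [p rQ]]] := realizes_exists (ss X) (i ▷ eps1).
  apply: (inflation_detection det rQ Fieps1).
  have [|th thf] := pull_exact_mid (z := q ▷ eps2) col3.
    by rewrite -push_pull -ieps1; exact: push_inflation rQ.
  rewrite thf; apply/ext_in_pull; apply: (det _ _ _ _ _ _ _ _ row3 Feps3).
  have [|t ->] := pull_exact_right (z := th ◁ h) col2; last exact: ext_in_push.
  rewrite -pull_comp -fe pull_comp -thf -push_pull.
  by rewrite (pull_deflation row2) push0.
- move=> keps2.
  have Feps3f : ext_in (eps3 ◁ f) by exact: ext_in_pull.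
  have [P [q [p rP]]] := realizes_exists (ss X) (eps3 ◁ f).
  apply: (det _ _ _ _ _ _ _ _ rP Feps3f).
  have [|th ith] := push_exact_mid (z := eps2 ◁ p) col1.
    by rewrite push_pull keps2; exact: pull_deflation rP.
  rewrite ith; apply/ext_in_push; apply: (inflation_detection det row1 Feps1).
  have [|t ->] := push_exact_right (z := a ▷ th) col2; last exact: ext_in_pull.
  rewrite -push_comp ja push_comp -ith push_pull.
  by rewrite (push_inflation row2) pull0.
Qed.

Lemma three_by_three_saturated : three_by_three xi -> saturated xi.
Proof.
move=> tbt A1 A2 B1 B2 Z M x1 y1 d1 x2 y2 d2 m1 e1 m2 e2 r1 r2 q1 q2 _ _ _ _.
move=> xi2 xiq; have Fd2 := ext_in_of xi2.
have [K [n [d3 [p [i [rK rip [xp ni pd3 d3y]]]]]]] := ET4op r2 q1.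
(* A1 -> K -> A2 has extension d1 y2 x2 = 0, whence the retraction of i below. *)
rewrite -pull_comp (deflation_inflation r2) pull0m in rip.
have Fd3 : ext_in d3.
  apply: (@ext_in_realized _ _ _ _ _ _ rK).
  apply: (tbt _ _ _ _ _ _ _ _ _ _ _ _ _ _ _ _ _ _ _ _ _ _ _ _ _ _ _
    (realizes_id_left _ A1) rK r2 rip q1 (realizes_id_right _ Z)) => //.
  - by rewrite compm1 ni.
  - by rewrite comp0m -compA (deflation_inflation q1) compm0.
  - by rewrite comp1m.
  - by right; split=> /=; rewrite ?comp1m ?pull_id.
  - exact: ext_in_zero.
  - exact: ext_in_zero.
  - exact: ext_in_zero.
have [q qi] := split_retraction rip.
have [|t tP] := pull_exact_right (z := d1 - q ▷ d3) r2.
  by rewrite pullB -push_pull d3y -push_comp qi push_id subrr.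
suff : ext_in d1 by apply.
rewrite -(subrK (q ▷ d3) d1) tP.
by apply: ext_in_add; exact: ext_in_push.
Qed.

End ProperClass.

Theorem corollary2p8 (X : extriangulated_category) (xi : etriangle X -> Prop)
  (hxi : proper_class xi) : saturated xi <-> three_by_three xi.
Proof.
split; first exact: saturated_three_by_three.
exact: three_by_three_saturated.
Qed.
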